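(* Let $X$ be a separable Banach space and let $C\subset X$ be a bounded, closed and convex subset with more than one element. Let $\mathcal{M}$ be the set of all non-expansive mappings $f\colon C\to C$, equipped with the metric $d(f,g)=\sup_{x\in C}\|f(x)-g(x)\|$. Then there is a $\sigma$-porous set $\widetilde{\mathcal{N}}\subset\mathcal{M}$ such that for every $f\in\mathcal{M}\setminus\widetilde{\mathcal{N}}$ the set \[ R(f)=\{x\in C : \operatorname{Lip}(f,x)=1\} \] is a residual subset of $C$.
   Context: For $f\colon C\to C$, $\operatorname{Lip}(f)=\sup\{\|f(y)-f(z)\|/\|y-z\| : y,z\in C,\ y\neq z\}$; $f$ is non-expansive if $\operatorname{Lip}(f)\le 1$. For $x\in C$, \[ \operatorname{Lip}(f,x)=\limsup_{r\to 0+}\ \sup\left\{\frac{\|f(y)-f(x)\|}{\|y-x\|} : y\in B(x,r)\cap C,\ y\neq x\right\}. \] A subset of $C$ is residual if its complement in $C$ is of first category (a countable union of nowhere dense sets) in $C$. Porosity: let $(P,d)$ be a non-empty metric space and $B(x,r)$ the open ball with centre $x$ and radius $r$. A subset $A\subset P$ is porous at $x\in A$ if there are constants $\alpha>0$ and $\varepsilon_0>0$ such that for all $\varepsilon\in(0,\varepsilon_0)$ there is a point $y\in P$ with $d(y,x)\le\varepsilon$ and $B(y,\alpha\varepsilon)\cap A=\emptyset$. $A$ is porous if it is porous at all of its points. A set $F\subset P$ is $\sigma$-porous if it is a countable union of porous sets. *)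

(* Defs.v *)
From HB Require Import structures.
From mathcomp Require Import all_boot all_order all_algebra.
From mathcomp Require Import all_classical all_reals all_analysis.

Set Implicit Arguments.
Unset Strict Implicit.
Unset Printing Implicit Defensive.

Import Order.TTheory GRing.Theory Num.Theory.
Import numFieldNormedType.Exports.

Local Open Scope classical_set_scope.
Local Open Scope ring_scope.

Definition separable (T : topologicalType) : Prop :=
  exists D : set T, countable D /\ dense D.

Definition nowhere_dense (T : topologicalType) (A : set T) : Prop :=
  interior (closure A) = set0.

Definition first_category (T : topologicalType) (A : set T) : Prop :=
  exists F : (set T)^nat,
    (forall n, nowhere_dense (F n)) /\ A = \bigcup_n F n.

Definition residual (T : topologicalType) (A : set T) : Prop :=
  first_category (~` A).

(* In a [metricType], [ball y r] is the open ball, see [ballEmdist]. *)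
Definition porous_at (R : realType) (P : metricType R) (A : set P) (x : P) :
    Prop :=
  exists alpha eps0 : R, [/\ 0 < alpha, 0 < eps0 &
    forall eps, 0 < eps -> eps < eps0 ->
      exists y : P, mdist y x <= eps /\ ball y (alpha * eps) `&` A = set0].

Definition porous (R : realType) (P : metricType R) (A : set P) : Prop :=
  forall x, A x -> porous_at A x.

Definition sigma_porous (R : realType) (P : metricType R) (F : set P) : Prop :=
  exists A : (set P)^nat, (forall n, porous (A n)) /\ F = \bigcup_n A n.

(* Self-maps of [C] are functions on the subtype [set_type C], which carries
   the topology induced by [X]. The Lipschitz constants are extended reals,
   since these suprema may be infinite. *)

Definition lip_quotient (R : realType) (X : normedModType R) (C : set X)
    (f : C -> C) (y z : C) : R :=
  `|set_val (f y) - set_val (f z)| / `|set_val y - set_val z|.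

Definition lip (R : realType) (X : normedModType R) (C : set X)
    (f : C -> C) : \bar R :=
  ereal_sup [set (lip_quotient f p.1 p.2)%:E |
             p in [set p : C * C | p.1 <> p.2]].

Definition lip_at (R : realType) (X : normedModType R) (C : set X)
    (f : C -> C) (x : C) : \bar R :=
  limf_esup (fun r : R =>
      ereal_sup [set (lip_quotient f y x)%:E |
                 y in [set y : C | ball (set_val x) r (set_val y) /\ y <> x]])
    0^'+.

Definition nonexpansive (R : realType) (X : normedModType R) (C : set X)
    (f : C -> C) : Prop := (lip f <= 1%:E)%E.

(* The boundedness proof is a parameter of the type so that the supremum
   distance below is finite and defines a metric on it. *)
Definition nonexpansive_map (R : realType) (X : normedModType R) (C : set X)
    (Cb : bounded_set C) : Type :=
  set_type [set f : C -> C | nonexpansive f].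

Definition nonexpansive_fun (R : realType) (X : normedModType R) (C : set X)
    (Cb : bounded_set C) (f : nonexpansive_map Cb) : C -> C := set_val f.

Coercion nonexpansive_fun : nonexpansive_map >-> Funclass.

Section sup_metric.
Context (R : realType) (X : normedModType R) (C : set X) (Cb : bounded_set C).
Local Notation M := (nonexpansive_map Cb).
Implicit Types f g h : M.

Definition sup_dist (f g : M) : R :=
  sup [set `|set_val (f x) - set_val (g x)| | x in [set: C]].

Lemma nonexpansive_map_ext f g : f =1 g -> f = g.
Proof. by move=> fg; apply: val_inj; apply/funext. Qed.

Lemma sup_dist_ubound f g :
  has_ubound [set `|set_val (f x) - set_val (g x)| | x in [set: C]].
Proof.
have [B [_ CB]] := Cb.
have norm_le (x : C) : `|set_val x| <= B + 1.
  by apply: (CB (B + 1)); [rewrite ltrDl|exact: set_valP].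
exists (B + 1 + (B + 1)) => _ [x _ <-].
by rewrite (le_trans (ler_normB _ _))// lerD.
Qed.

Lemma le_sup_dist f g x : `|set_val (f x) - set_val (g x)| <= sup_dist f g.
Proof. by apply: ub_le_sup; [exact: sup_dist_ubound|exists x]. Qed.


Lemma sup_dist_le f g e : 0 <= e ->
  (forall x, `|set_val (f x) - set_val (g x)| <= e) -> sup_dist f g <= e.
Proof.
move=> e0 fge; rewrite /sup_dist; set S := (X in sup X).
have [->|/set0P S0] := eqVneq S set0; first by rewrite sup0.
by apply: ge_sup => // _ [x _ <-].
Qed.

Lemma sup_dist_ge0 f g : 0 <= sup_dist f g.
Proof.
rewrite /sup_dist; set S := (X in sup X).
have [->|/set0P [_ [x _ _]]] := eqVneq S set0; first by rewrite sup0.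
exact: le_trans (le_sup_dist f g x).
Qed.

Lemma sup_distxx f : sup_dist f f = 0.
Proof.
apply/eqP; rewrite eq_le sup_dist_ge0 andbT.
by apply: sup_dist_le => // x; rewrite subrr normr0.
Qed.

Lemma sup_dist_positivity f g : sup_dist f g = 0 -> f = g.
Proof.
move=> fg0; apply: nonexpansive_map_ext => x; apply: val_inj.
apply/eqP; rewrite -subr_eq0 -normr_le0 -fg0; exact: le_sup_dist.
Qed.

Lemma sup_dist_sym f g : sup_dist f g = sup_dist g f.
Proof.
by congr sup; apply: eq_imagel => x _; rewrite distrC.
Qed.

Lemma sup_dist_triangle g f h : sup_dist f h <= sup_dist f g + sup_dist g h.
Proof.
apply: sup_dist_le => [|x]; first by rewrite addr_ge0// sup_dist_ge0.
by rewrite (le_trans (ler_distD (set_val (g x)) _ _))// lerD// le_sup_dist.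
Qed.

HB.instance Definition _ := Choice.on M.

HB.instance Definition _ := isMetric.Build R M
  sup_distxx sup_dist_positivity sup_dist_sym sup_dist_triangle.

Lemma mdist_nonexpansive_map f g : mdist f g = sup_dist f g.
Proof. by []. Qed.

End sup_metric.

Definition lip_one_set (R : realType) (X : normedModType R) (C : set X)
    (f : C -> C) : set C := [set x | lip_at f x = 1%:E].

(* Main.v *)
(* If [f] is not a strict contraction on any relative ball of [C], then for
   every [r > 0] and [a < 1] the points [x] with
   [|f y - f x| <= a |y - x|] for all [y] in [B(x, r)] form a nowhere dense set,
   since on a small ball inside the closure of this set [f] would be
   [a]-Lipschitz; so [lip_at f x = 1] for residually many [x]. By separability it
   suffices to exclude countably many balls [U] and constants [a < 1], and it
   remains to see that the maps that are [a]-Lipschitz on [U] form a porous set.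
   Such an [f] is perturbed by at most [e] to a non-expansive [g] whose slope
   exceeds some [b > a] at scale comparable with [e]; maps much closer than [e]
   to [g] are then not [a]-Lipschitz on [U].
   - If [f] is constant on [U], let [g] pull the values of [f] on a ball of
     radius [e] towards another point of [C] at unit speed.
   - Otherwise let [L] be the Lipschitz constant of [f] on [U]. Precompose [f]
     with a [1/L]-Lipschitz map that moves the points of a small ball towards a
     fixed [w] and stretches, almost by the factor [1/L], a short segment on which
     the slope of [f] is almost [L]. *)

Require Import Defs.
From HB Require Import structures.
From mathcomp Require Import all_boot all_order all_algebra.
From mathcomp Require Import all_classical all_reals all_analysis.
From mathcomp Require Import ring lra.

Set Implicit Arguments.
Unset Strict Implicit.
Unset Printing Implicit Defensive.

Import Order.TTheory GRing.Theory Num.Theory.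
Import numFieldNormedType.Exports.

Local Open Scope classical_set_scope.
Local Open Scope ring_scope.

(** * Cone-shaped bump functions *)

Definition cone (R : realType) (X : normedModType R) (r k : R) (p x : X) : R :=
  k * Num.max 0 (r - `|x - p|).

Section cone.
Context (R : realType) (X : normedModType R).
Implicit Types (r k : R) (p x y : X).

Lemma cone_ge0 r k p x : 0 <= k -> 0 <= cone r k p x.
Proof. by move=> k0; rewrite /cone mulr_ge0// le_max lexx. Qed.

Lemma cone_le r k p x : 0 <= k -> 0 <= r -> cone r k p x <= k * r.
Proof.
by move=> k0 r0; rewrite /cone ler_wpM2l// ge_max r0 gerBl normr_ge0.
Qed.

Lemma cone_out r k p x : r <= `|x - p| -> cone r k p x = 0.
Proof. by move=> rx; rewrite /cone max_l ?mulr0// subr_le0. Qed.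

Lemma cone_center r k p : 0 <= r -> cone r k p p = k * r.
Proof. by move=> r0; rewrite /cone subrr normr0 subr0 max_r. Qed.

Lemma cone_lipschitz r k p x y : 0 <= k ->
  `|cone r k p x - cone r k p y| <= k * `|x - y|.
Proof.
move=> k0; rewrite -mulrBr normrM ger0_norm// ler_wpM2l//.
have h1 : `|x - p| <= `|x - y| + `|y - p| by exact: ler_distD.
have h2 : `|y - p| <= `|x - y| + `|x - p| by rewrite (distrC x y); exact: ler_distD.
have h3 := normr_ge0 (x - y).
by rewrite /Num.max ler_norml; do 2 case: ltP => ?; apply/andP; split; lra.
Qed.

End cone.

(** * Segments in a convex set and gluing of non-expansive maps *)

Section convex_domain.
Context (R : realType) (X : normedModType R) (C : set X).
Hypothesis Cconvex : @convex_set R X C.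
Local Notation v := (@set_val X C).
Implicit Types (x y u w : C) (t : R).

(** [insubd] makes this total; for [t] in the unit interval convexity of [C] excludes the fallback
    value [x]. *)
Definition seg x y t : C := insubd x (v x + t *: (v y - v x)).

Lemma val_seg x y t : 0 <= t -> t <= 1 -> v (seg x y t) = v x + t *: (v y - v x).
Proof.
move=> t0 t1; rewrite /seg; set z : X := v x + _.
suff zC : z \in C by exact: (insubdK x zC).
have -> : z = t *: v y + (1 - t) *: v x.
  by rewrite /z scalerBr scalerBl scale1r addrCA.
exact: Cconvex (Itv01 t0 t1) (mem_set (set_valP y)) (mem_set (set_valP x)).
Qed.

Lemma seg_dist x y s t : 0 <= s -> s <= 1 -> 0 <= t -> t <= 1 ->
  v (seg x y t) - v (seg x y s) = (t - s) *: (v y - v x).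
Proof.
by move=> *; rewrite !val_seg// scalerBl opprD addrACA subrr add0r.
Qed.

Lemma seg_end x y t : 0 <= t -> t <= 1 ->
  v y - v (seg x y t) = (1 - t) *: (v y - v x).
Proof. by move=> *; rewrite val_seg// scalerBl scale1r opprD addrA. Qed.

Lemma seg_ball x y t (p : X) s : 0 <= t -> t <= 1 ->
  `|v x - p| < s -> `|v y - p| < s -> `|v (seg x y t) - p| < s.
Proof.
move=> t0 t1 xs ys; rewrite val_seg//.
have -> : v x + t *: (v y - v x) - p = (1 - t) *: (v x - p) + t *: (v y - p).
  have -> : v y - v x = (v y - p) - (v x - p) by rewrite opprB addrA subrK.
  by rewrite scalerBr scalerBl scale1r addrAC addrA (addrAC (v x - p)).
apply: le_lt_trans (ler_normD _ _) _.
rewrite !normrZ ger0_norm ?subr_ge0// (ger0_norm t0).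
have [->|tN0] := eqVneq t 0; first by rewrite subr0 mul1r mul0r addr0.
have : (1 - t) * `|v x - p| <= (1 - t) * s by rewrite ler_wpM2l ?subr_ge0// ltW.
have : t * `|v y - p| < t * s by rewrite ltr_pM2l// lt_def tN0.
lra.
Qed.

Lemma nonexpansiveP (f : C -> C) : nonexpansive f <->
  forall x y, `|v (f x) - v (f y)| <= `|v x - v y|.
Proof.
split=> [fne x y|fle]; last first.
  apply: ge_ereal_sup => _ [[x y]/= xy <-]; rewrite lee_fin /lip_quotient/=.
  have xy0 : 0 < `|v x - v y|.
    by rewrite normr_gt0 subr_eq0; apply/eqP => /val_inj.
  by rewrite ler_pdivrMr// mul1r.
have [->|/eqP xy] := eqVneq x y; first by rewrite !subrr.
have xy0 : 0 < `|v x - v y|.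
  by rewrite normr_gt0 subr_eq0; apply/eqP => /val_inj.
have : ((lip_quotient f x y)%:E <= 1%:E)%E.
  by apply: le_trans fne; apply: ereal_sup_ubound; exists (x, y).
by rewrite lee_fin /lip_quotient ler_pdivrMr// mul1r.
Qed.

(* Along a segment leaving the small ball there is a point on its boundary
   sphere, where [f] and [g] agree and [g] is already controlled. *)
Lemma nonexpansive_glue (f g : C -> C) (p : X) (r r' : R) : r < r' ->
  nonexpansive f ->
  (forall x, r <= `|v x - p| -> g x = f x) ->
  (forall x y, `|v x - p| < r' -> `|v y - p| < r' ->
    `|v (g x) - v (g y)| <= `|v x - v y|) ->
  nonexpansive g.
Proof.
move=> rr' /nonexpansiveP fne gf gloc; apply/nonexpansiveP.
have mixed x y : `|v x - p| < r -> r <= `|v y - p| ->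
    `|v (g x) - v (g y)| <= `|v x - v y|.
  move=> xr yr.
  pose F t := `|v x + t *: (v y - v x) - p|.
  have Fc : {within `[0, 1], continuous F}.
    apply: continuous_subspaceT => t; apply: cvg_norm.
    apply: cvgB; last exact: cvg_cst.
    by apply: cvgD; [exact: cvg_cst|apply: cvgZr_tmp; exact: cvg_id].
  have F0 : F 0 = `|v x - p| by rewrite /F scale0r addr0.
  have F1 : F 1 = `|v y - p| by rewrite /F scale1r (addrC (v x)) subrK.
  have [|t] := @IVT R F 0 1 r ler01 Fc.
    by rewrite F0 F1 ge_min le_max (ltW xr) yr orbT.
  rewrite in_itv/= => /andP[t0 t1] Ft.
  pose z := seg x y t.
  have zp : `|v z - p| = r by rewrite /z val_seg.
  have gz : g z = f z by apply: gf; rewrite zp.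
  have := gloc x z (lt_trans xr rr'); rewrite zp gz => /(_ rr') xz.
  have zy := fne z y.
  rewrite (gf y yr); apply: le_trans (ler_distD (v (f z)) _ _) _.
  apply: le_trans (lerD xz zy) _.
  have -> : v x - v z = (- t) *: (v y - v x).
    by rewrite /z val_seg// opprD addrA subrr add0r scaleNr.
  have -> : v z - v y = (t - 1) *: (v y - v x).
    by rewrite -opprB seg_end// -scaleNr opprB.
  rewrite !normrZ normrN (ger0_norm t0) ler0_norm ?subr_le0//.
  by rewrite (distrC (v x)); lra.
move=> x y.
have [xr|xr] := ltP `|v x - p| r; have [yr|yr] := ltP `|v y - p| r.
- by apply: gloc; exact: lt_trans rr'.
- exact: mixed.
- by rewrite distrC (distrC (v x)); exact: mixed.
- by rewrite !gf.
Qed.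

(** * Perturbations that make a map steeper *)

Definition lip_le_on (f : C -> C) (U : set C) (a : R) : Prop :=
  forall x y, U x -> U y -> `|v (f x) - v (f y)| <= a * `|v x - v y|.

(* The constant [k] may depend on [f]; this suffices for porosity and spares a
   decomposition according to the Lipschitz constant of [f] on [U]. *)
Definition steepable (f : C -> C) (U : set C) (b : R) : Prop :=
  exists k e0 : R, [/\ 0 < k, 0 < e0 & forall e, 0 < e -> e < e0 ->
    exists g : C -> C, [/\ nonexpansive g, forall x, `|v (g x) - v (f x)| <= e &
      exists x y, [/\ U x, U y, k * e <= `|v x - v y| &
        b * `|v x - v y| <= `|v (g x) - v (g y)|]]].

Definition relball (d : X) (s : R) : set C := [set x | `|v x - d| < s].

(** Only [y] is compared with [w], so in a bound near a fixed centre [x] may lie far away. *)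
Lemma seg_lip x y w s t : 0 <= s -> s <= 1 -> 0 <= t -> t <= 1 ->
  `|v (seg x w s) - v (seg y w t)| <=
  (1 - s) * `|v x - v y| + `|s - t| * `|v w - v y|.
Proof.
move=> s0 s1 t0 t1; rewrite !val_seg//.
have -> : v x + s *: (v w - v x) - (v y + t *: (v w - v y)) =
    (1 - s) *: (v x - v y) + (s - t) *: (v w - v y).
  have -> : v w - v x = (v w - v y) - (v x - v y) by rewrite opprB addrA subrK.
  rewrite scalerBr !scalerBl scale1r opprD addrACA.
  by rewrite -[RHS]addrA; congr (_ + _); rewrite addrCA addrA.
by apply: le_trans (ler_normD _ _) _; rewrite !normrZ ger0_norm ?subr_ge0.
Qed.

Lemma relball_split d s x : relball d s x ->
  exists2 r0, 0 < r0 & `|v x - d| + r0 < s.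
Proof.
by rewrite /relball/= => xs; exists ((s - `|v x - d|) / 2); lra.
Qed.

(** In the [e]-ball around [p] the new value lies on the segment from [f p] to [z], at distance
    [e - |x - p|] from [f p]; hence slope 1 along rays from [p]. *)
Lemma steepable_const (f : C -> C) (d : X) (s : R) p q z :
  nonexpansive f -> relball d s p -> q <> p -> z <> f p ->
  (forall x, relball d s x -> f x = f p) -> steepable f (relball d s) 1.
Proof.
move=> fne Up qp zp fc.
have D0 : 0 < `|v z - v (f p)|.
  by rewrite normr_gt0 subr_eq0; apply/eqP => /val_inj.
have E0 : 0 < `|v q - v p|.
  by rewrite normr_gt0 subr_eq0; apply/eqP => /val_inj.
set D := `|v z - v (f p)| in D0; set E := `|v q - v p| in E0.
have [r0 r00 r0s] := relball_split Up.
(* [r0] keeps the change where [f] is constant, [D] keeps the bump below 1, and [E] leaves room for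
   a point at distance [e] from [p]. *)
exists 1, (Num.min r0 (Num.min D E)); split; rewrite ?lt_min ?r00 ?D0//.
move=> e e0; rewrite !lt_min => /and3P[er eD eE].
pose b x := cone e D^-1 (v p) (v x).
have Dv0 : 0 <= D^-1 by rewrite invr_ge0 ltW.
have b0 x : 0 <= b x by exact: cone_ge0.
have be x : b x <= e / D by rewrite mulrC; apply: cone_le => //; exact: ltW.
have b1 x : b x <= 1.
  by rewrite (le_trans (be x))// ler_pdivrMr// mul1r ltW.
have bout x : e <= `|v x - v p| -> b x = 0 by exact: cone_out.
pose g x := seg (f x) z (b x).
have gout x : e <= `|v x - v p| -> g x = f x.
  move=> ex; apply: val_inj; rewrite /g [LHS]val_seg//.
  by rewrite bout// scale0r addr0.
have inU x : `|v x - v p| < r0 -> f x = f p.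
  move=> xr; apply: fc; rewrite /relball/=.
  by have := ler_distD (v p) (v x) d; lra.
have gloc x y : `|v x - v p| < r0 -> `|v y - v p| < r0 ->
    `|v (g x) - v (g y)| = `|b x - b y| * D.
  move=> xr yr; rewrite /g (inU _ xr) (inU _ yr) !val_seg//.
  by rewrite opprD addrACA subrr add0r -scalerBl normrZ.
have blip x y : `|b x - b y| * D <= `|v x - v y|.
  by rewrite -ler_pdivlMr// mulrC; exact: cone_lipschitz.
exists g; split.
- apply: (nonexpansive_glue er fne gout) => x y xr yr.
  by rewrite gloc.
- move=> x; have [xe|xe] := ltP `|v x - v p| e; last first.
    by rewrite gout// subrr normr0 ltW.
  rewrite /g val_seg// addrAC subrr add0r normrZ ger0_norm// inU; last first.
    exact: lt_trans er.
  by rewrite -ler_pdivlMr.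
have eE0 : 0 <= e / E by rewrite divr_ge0 ?ltW.
have eE1 : e / E <= 1 by rewrite ler_pdivrMr// mul1r ltW.
pose q' := seg p q (e / E).
have q'p : `|v q' - v p| = e.
  rewrite val_seg// addrAC subrr add0r normrZ ger0_norm//.
  by rewrite -/E divfK ?gt_eqF.
exists q', p; split => //.
- rewrite /relball/=.
  by have := ler_distD (v p) (v q') d; lra.
- by rewrite mul1r q'p.
rewrite gloc ?q'p// ?subrr ?normr0//.
rewrite bout ?q'p// {1}/b cone_center ?(ltW e0)// sub0r normrN ger0_norm.
  by rewrite mul1r mulrAC mulVf ?gt_eqF// mul1r.
by rewrite mulr_ge0// ltW.
Qed.

(** * Stretching a short steep segment *)

Lemma steep_step (F : nat -> X) (c : R) (n : nat) : (0 < n)%N ->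
  n%:R * c <= `|F n - F 0%N| -> exists2 i, (i < n)%N & c <= `|F i.+1 - F i|.
Proof.
elim: n => // n IH _ Fn.
have [cF|cF] := leP c `|F n.+1 - F n|; first by exists n.
have tri := ler_distD (F n) (F n.+1) (F 0%N).
case: n => [|n] in IH Fn cF tri *; first by rewrite mul1r leNgt cF in Fn.
have [//||i ni ci] := IH; last by exists i => //; exact: ltnW.
by rewrite -[n.+2%:R]natr1 mulrDl mul1r in Fn; lra.
Qed.

(** One plus the integer part of [l / rho] is at most [2 * l / rho], because [l / rho >= 1]. *)
Lemma halving_scale (l rho : R) : 0 < rho -> rho <= l ->
  exists2 n, (0 < n)%N & rho / 2 <= l / n%:R <= rho.
Proof.
move=> rho0 rhol; have l0 : 0 < l by exact: lt_le_trans rhol.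
have q1 : 1 <= l / rho by rewrite ler_pdivlMr// mul1r.
have /andP[nl nu] := truncn_itv (le_trans ler01 q1).
set n := Num.truncn _ in nl nu; exists n.+1 => //.
rewrite ler_pdivlMr ?ltr0n// ler_pdivrMr ?ltr0n//.
move: nl nu; rewrite ler_pdivlMr// ltr_pdivrMr// => nl nu.
apply/andP; split; last by rewrite mulrC ltW.
by rewrite -[n.+1%:R]natr1; lra.
Qed.

Lemma seg0 x y : seg x y 0 = x.
Proof. by apply: val_inj; rewrite [LHS]val_seg// scale0r addr0. Qed.

(** The half of [[u, w]] next to [u] is cut into steps of length [S * r]; on one of them [f] has
    slope at least [c]. Precomposition carries a segment of length [r] onto that step, which
    multiplies the slope by [S]. *)
Lemma steepable_stretch (f : C -> C) (d : X) (s L S c : R) u w :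
  nonexpansive f -> 0 < L -> 1 < S -> S * L < 1 ->
  lip_le_on f (relball d s) L ->
  relball d s u -> relball d s w -> u <> w ->
  c * (`|v w - v u| / 2) <= `|v (f (seg u w 2^-1)) - v (f u)| ->
  steepable f (relball d s) (c * S).
Proof.
move=> fne L0 S1 SL fL Uu Uw uw fc.
set Lw := `|v w - v u| in fc *.
have Lw0 : 0 < Lw by rewrite normr_gt0 subr_eq0; apply/eqP => /val_inj/esym.
have [ru ru0 rus] := relball_split Uu; have [rw rw0 rws] := relball_split Uw.
have [r0 [r00 u_r0 w_r0]] : exists r0,
    [/\ 0 < r0, `|v u - d| < s - r0 & `|v w - d| < s - r0].
  exists (Num.min ru rw); rewrite lt_min ru0 rw0.
  by case: (leP ru rw) => ?; split=> //; lra.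
pose K := L^-1.
have LK : L * K = 1 by rewrite divff ?gt_eqF.
have SK : S < K by rewrite -(ltr_pM2r L0) mulrC (mulrC K) LK mulrC.
have K1 : 0 < K - 1 by lra.
have S10 : 0 < S - 1 by lra.
have S0 : 0 < S by lra.
have KS0 : 0 < K - S by lra.
(* The three bounds leave room for at least one step, keep the perturbed ball where [L] is valid,
   and make [phi] below [K]-Lipschitz. *)
pose m0 := Num.min (Lw / 2 / S) (Num.min r0 ((K - S) * (Lw / 2) / (S - 1))).
have m00 : 0 < m0.
  by rewrite !lt_min r00 !divr_gt0// mulr_gt0// divr_gt0.
(* [phi] will move points by at most [(K - 1) * rho = e], and [r >= rho / 2]; this dictates both
   constants. *)
exists (2 * (K - 1))^-1, ((K - 1) * m0); split.
- by rewrite invr_gt0 mulr_gt0.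
- exact: mulr_gt0.
move=> e e0 em0.
pose rho := e / (K - 1).
have rho0 : 0 < rho by rewrite divr_gt0.
have : rho < m0 by rewrite ltr_pdivrMr// mulrC.
rewrite !lt_min => /and3P[/ltW rhoL rhor0 rhoKS].
have [n n0] := halving_scale rho0 rhoL.
set r := _ / n%:R => /andP[rho_r r_rho].
have nR0 : 0 < n%:R :> R by rewrite ltr0n.
have rgt0 : 0 < r by rewrite !divr_gt0.
have r_r0 : r < r0 by exact: le_lt_trans rhor0.
have rSn : n%:R * (S * r) = Lw / 2.
  by rewrite /r; field; rewrite !gt_eqF.
have rKS : (S - 1) * r <= (K - S) * (Lw / 2).
  by rewrite mulrC -ler_pdivlMr//; lra.
have rSL : (S - 1) * r <= Lw / 2.
  rewrite -rSn; apply: (@le_trans _ _ (S * r)); first lra.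
  by rewrite ler_peMl ?ler1n// mulr_ge0// ltW.
pose h := r / Lw.
have h0 : 0 < h by rewrite divr_gt0.
have hL : h * Lw = r by rewrite divfK// gt_eqF.
have nSh : n%:R * (S * h) = 2^-1.
  by rewrite /h mulrA mulrA -(mulrA _ S) rSn; field; rewrite gt_eqF.
(* The [n] steps of parameter length [S * h] lead from [u] exactly to the midpoint. *)
pose F (i : nat) := v (f (seg u w (i%:R * (S * h)))).
have [|i ni Fi] := @steep_step F (c * (S * r)) n n0.
  by rewrite /F mul0r seg0 nSh mulrCA rSn.
pose tP := i%:R * (S * h).
have Sh0 : 0 < S * h by exact: mulr_gt0.
have tP0 : 0 <= tP by rewrite mulr_ge0// ltW.
have tQ12 : tP + S * h <= 2^-1.
  rewrite -nSh -[X in _ + X]mul1r -mulrDl [_ + 1]natr1.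
  by rewrite ler_pM2r// ler_nat.
have tQE : i.+1%:R * (S * h) = tP + S * h by rewrite -natr1 mulrDl mul1r.
pose tp := tP + h.
have h_Sh : h < S * h by rewrite ltr_pMl.
have tp0 : 0 <= tp by rewrite /tp; lra.
have tp12 : tp <= 2^-1 by rewrite /tp; lra.
have tp1 : tp <= 1 by lra.
have tP1 : tP <= 1 by lra.
pose P := seg u w tP; pose p := seg u w tp.
have Pp : `|v P - v p| = r.
  by rewrite distrC seg_dist// normrZ /tp addrAC subrr add0r gtr0_norm.
pose D := `|v w - v p|.
have DE : D = (1 - tp) * Lw.
  by rewrite /D seg_end// normrZ ger0_norm// subr_ge0.
have DL : Lw / 2 <= D by rewrite DE mulrC ler_pM2r//; lra.
have D0 : 0 < D by rewrite (lt_le_trans _ DL)// divr_gt0.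
(* With this slope [p] moves by [k * r * D = (S - 1) * r] towards [w], to the end of the chosen
   step, while [P], at distance [r] from [p], stays fixed. *)
pose k := (S - 1) / D.
have k0 : 0 <= k by rewrite divr_ge0// ltW.
pose b x := cone r k (v p) (v x).
have bkr x : b x <= k * r by apply: cone_le => //; exact: ltW.
have b0 x : 0 <= b x by exact: cone_ge0.
have b1 x : b x <= 1.
  rewrite (le_trans (bkr x))// mulrAC ler_pdivrMr// mul1r.
  exact: le_trans DL.
(* [phi] maps the segment [P, p] onto the longer segment of [u, w] whose
   endpoints have parameters [tP] and [tP + S * h]. *)
pose phi x := seg x w (b x).
have phiout x : r <= `|v x - v p| -> phi x = x.
  by move=> rx; rewrite /phi /b cone_out// seg0.
have kDr : k * (D + r) <= K - 1.
  rewrite mulrAC ler_pdivrMr//.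
  have : (K - S) * (Lw / 2) <= (K - S) * D by rewrite ler_pM2l.
  lra.
have w_in x : `|v x - v p| < r -> `|v w - v x| <= D + r.
  move=> xr; apply: le_trans (ler_distD (v p) _ _) _.
  by rewrite lerD// distrC ltW.
have philip x y : `|v (phi x) - v (phi y)| <= K * `|v x - v y|.
  have main x' y' : `|v y' - v p| < r ->
      `|v (phi x') - v (phi y')| <= K * `|v x' - v y'|.
    move=> yr; apply: le_trans (seg_lip _ _ _ _ _ _ _) _ => //.
    have bl := cone_lipschitz r (v p) (v x') (v y') k0.
    have : `|b x' - b y'| * `|v w - v y'| <= k * `|v x' - v y'| * (D + r).
      by apply: ler_pM => //; exact: w_in.
    have : k * (D + r) * `|v x' - v y'| <= (K - 1) * `|v x' - v y'|.
      by rewrite ler_wpM2r.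
    have : 0 <= b x' * `|v x' - v y'| by rewrite mulr_ge0.
    lra.
  have [yr|yr] := ltP `|v y - v p| r; first exact: main.
  have [xr|xr] := ltP `|v x - v p| r.
    by rewrite distrC (distrC (v x)); exact: main.
  by rewrite !phiout// ler_peMl//; lra.
have p_r0 : `|v p - d| < s - r0 by exact: seg_ball.
have near_U x : `|v x - v p| < r0 -> relball d s x.
  by move=> xr; rewrite /relball/=; have := ler_distD (v p) (v x) d; lra.
have UP : relball d s P by exact: seg_ball.
have Up : relball d s p by rewrite /relball/=; lra.
exists (f \o phi); split.
- apply: (@nonexpansive_glue f _ (v p) _ _ r_r0 fne) => [x xr|x y xr yr] /=.
    by rewrite phiout.
  (* Convexity of the ball keeps [phi] inside it, and [L * K = 1]. *)
  apply: le_trans (fL _ _ _ _) _.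
  + by apply: seg_ball => //; exact: near_U.
  + by apply: seg_ball => //; exact: near_U.
  by rewrite -[leRHS]mul1r -LK -mulrA ler_pM2l.
- move=> x /=; apply: le_trans ((iffLR (nonexpansiveP _)) fne _ _) _.
  have [xr|xr] := ltP `|v x - v p| r; last first.
    by rewrite phiout// subrr normr0 ltW.
  rewrite /phi val_seg// addrAC subrr add0r normrZ ger0_norm//.
  apply: (@le_trans _ _ (k * r * (D + r))).
    by apply: ler_pM => //; exact: w_in.
  rewrite mulrAC; apply: (@le_trans _ _ ((K - 1) * rho)).
    by apply: ler_pM => //; [rewrite mulr_ge0// addr_ge0// ltW|exact: ltW].
  by rewrite /rho mulrC divfK// gt_eqF.
exists P, p; split=> //.
- by rewrite Pp (le_trans _ rho_r)// /rho invfM; lra.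
rewrite Pp -mulrA distrC /= (phiout P) ?Pp//.
suff -> : phi p = seg u w (i.+1%:R * (S * h)) by exact: Fi.
apply: val_inj; rewrite tQE [LHS]val_seg// [RHS]val_seg//; last 2 first.
- by lra.
- by lra.
rewrite seg_end// val_seg// scalerA -addrA -scalerDl; congr (_ + _ *: _).
rewrite /b cone_center ?(ltW rgt0)//.
have -> : k * r * (1 - tp) = (S - 1) * h.
  rewrite /k DE -hL; field; rewrite !gt_eqF//.
  by lra.
by rewrite /tp; lra.
Qed.

Lemma steepable_nonconst (f : C -> C) (d : X) (s a : R) x0 y0 :
  nonexpansive f -> a < 1 -> lip_le_on f (relball d s) a ->
  relball d s x0 -> relball d s y0 -> f x0 <> f y0 ->
  exists2 b, a < b & steepable f (relball d s) b.
Proof.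
move=> fne a1 fa Ux0 Uy0 f0.
have dist_gt0 x y : x <> y -> 0 < `|v x - v y|.
  by move=> xy; rewrite normr_gt0 subr_eq0; apply/eqP => /val_inj.
have x0y0 : x0 <> y0 by move=> /(congr1 f).
pose Q := [set q : R | exists x y,
  [/\ relball d s x, relball d s y, x <> y & q = lip_quotient f x y]].
have Qa : ubound Q a.
  by move=> _ [x [y [Ux Uy xy ->]]]; rewrite ler_pdivrMr ?fa ?dist_gt0.
have Qub : has_ubound Q by exists a.
have Q0 : Q (lip_quotient f x0 y0) by exists x0, y0.
have Qn0 : Q !=set0 by eexists; exact: Q0.
pose L := sup Q.
have La : L <= a by exact: ge_sup.
have L0 : 0 < L.
  by apply: lt_le_trans (ub_le_sup Qub Q0); rewrite divr_gt0 ?dist_gt0.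
have fL : lip_le_on f (relball d s) L.
  move=> x y Ux Uy; have [->|/eqP xy] := eqVneq x y.
    by rewrite !subrr !normr0 mulr0.
  rewrite -ler_pdivrMr ?dist_gt0//; apply: ub_le_sup Qub _ _.
  by exists x, y.
(* [c] falls short of [L], and [S] of [1 / L], by the same factor [(1 + a) / 2], whose square
   exceeds [a]. *)
pose c := L * ((1 + a) / 2); pose S := (1 + a) / 2 / L.
have a12 : a < (1 + a) / 2 by lra.
have cL : c < L by rewrite /c gtr_pMr//; lra.
have [_ [u [w [Uu Uw uw ->]]] cuw] := sup_gt Qn0 cL.
have SL : S * L < 1 by rewrite /S divfK ?gt_eqF//; lra.
have S1 : 1 < S by rewrite ltr_pdivlMr// mul1r; lra.
have cS : a < c * S.
  have -> : c * S = ((1 + a) / 2) ^+ 2.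
    by rewrite /c /S; field; rewrite gt_eqF.
  have : 0 < ((1 - a) / 2) ^+ 2 by rewrite exprn_gt0//; lra.
  lra.
exists (c * S) => //.
have := ltW cuw; rewrite ler_pdivlMr ?dist_gt0// => {}cuw.
(* The half of the segment [u, w] with the larger slope is stretched towards the
   other end, which stays at distance at least [|w - u| / 2]. *)
have mE : seg u w 2^-1 = seg w u 2^-1.
  have h0 : 0 <= 2^-1 :> R by lra.
  have h1 : 2^-1 <= 1 :> R by lra.
  apply: val_inj; rewrite [LHS]val_seg// [RHS]val_seg//.
  have -> : 2^-1 *: (v u - v w) = (v u - v w) - 2^-1 *: (v u - v w).
    by rewrite -[X in _ = X - _]scale1r -scalerBl; congr (_ *: _); lra.
  by rewrite -scalerN opprB addrA (addrC (v w)) subrK.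
have tri := ler_distD (v (f (seg u w 2^-1))) (v (f u)) (v (f w)).
have [half|half] := leP (c * (`|v w - v u| / 2))
    `|v (f (seg u w 2^-1)) - v (f u)|.
  exact: (steepable_stretch fne L0 S1 SL fL Uu Uw uw half).
apply: (steepable_stretch fne L0 S1 SL fL Uw Uu (not_eq_sym uw)).
rewrite -mE.
rewrite (distrC (v w)) in half.
rewrite (distrC (v (f u)) (v (f (seg u w 2^-1)))) in tri.
lra.
Qed.

(** * Porosity of the sets of local contractions *)

Hypothesis Cnontriv : exists x y : X, [/\ C x, C y & x <> y].

Lemma other_point (p : C) : exists q : C, q <> p.
Proof.
have [x [y [Cx Cy xy]]] := Cnontriv.
have [xp|] := EM (SigSub (mem_set Cx) = p); last by exists (SigSub (mem_set Cx)).
exists (SigSub (mem_set Cy)) => yp; apply: xy.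
by have := congr1 v (etrans xp (esym yp)).
Qed.

Lemma steepable_contraction (f : C -> C) (d : X) (s a : R) (p : C) :
  nonexpansive f -> a < 1 -> lip_le_on f (relball d s) a ->
  relball d s p -> exists2 b, a < b & steepable f (relball d s) b.
Proof.
move=> fne a1 fa Up.
have [[x [Ux fx]]|fc] := EM (exists x, relball d s x /\ f x <> f p).
  exact: (steepable_nonconst fne a1 fa Ux Up fx).
exists 1 => //.
have [q qp] := other_point p; have [z zp] := other_point (f p).
apply: (steepable_const fne Up qp zp) => x Ux.
by apply: contrapT => fx; apply: fc; exists x.
Qed.

(** Non-emptiness matters: on an empty ball every map qualifies vacuously, and the whole space is
    not porous. *)
Definition contraction_on (Cb : bounded_set C) (d : X) (s a : R) :
    set (nonexpansive_map Cb) :=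
  [set f | (relball d s : set C) !=set0 /\ lip_le_on f (relball d s) a].

Lemma porous_contraction_on (Cb : bounded_set C) (d : X) (s a : R) :
  a < 1 -> porous (@contraction_on Cb d s a).
Proof.
move=> a1 f [[p Up] fa].
have fne : nonexpansive (nonexpansive_fun f) by exact: (set_valP f).
have [b ab [k [e0 [k0 e00 steep]]]] := steepable_contraction fne a1 fa Up.
have ba0 : 0 < b - a by lra.
(* A map this close to [g] changes the increment over [x, y] by less than [(b - a) * k * e / 2],
   while the gap [(b - a) * |x - y|] is at least [(b - a) * k * e]. *)
exists ((b - a) * k / 4), e0; split=> //.
  by rewrite divr_gt0// mulr_gt0.
move=> e egt0 ee0.
have [g [gne gf [x [y [Ux Uy exy bxy]]]]] := steep _ egt0 ee0.
pose g' : nonexpansive_map Cb := SigSub (mem_set gne).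
exists g'; split.
  by rewrite mdist_nonexpansive_map; apply: sup_dist_le => //; exact: ltW.
suff far (h : nonexpansive_map Cb) : sup_dist g' h < (b - a) * k / 4 * e ->
    ~ lip_le_on h (relball d s) a.
  apply/seteqP; split=> // h [+ [_ ha]].
  by rewrite ballEmdist/= mdist_nonexpansive_map => /far.
move=> gh ha.
have gx := le_sup_dist g' h x; have gy := le_sup_dist g' h y.
rewrite distrC in gy.
have h1 := ler_distD (v (h x)) (v (g x)) (v (g y)).
have h2 := ler_distD (v (h y)) (v (h x)) (v (g y)).
have h3 := ha _ _ Ux Uy.
have h4 : (b - a) * (k * e) <= (b - a) * `|v x - v y| by rewrite ler_pM2l.
have h5 : 0 < (b - a) * (k * e) by rewrite !mulr_gt0.
rewrite /nonexpansive_fun/= in gx gy; rewrite /nonexpansive_fun/= in h1 h2 h3.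
lra.
Qed.

End convex_domain.

(** * Local Lipschitz constants and residuality *)

Definition invS (R : realType) (n : nat) : R := n.+1%:R^-1.

Lemma invS_gt0 (R : realType) n : 0 < invS R n.
Proof. by rewrite invr_gt0 ltr0n. Qed.

Lemma invS_lt (R : realType) (e : R) : 0 < e -> exists n, invS R n < e.
Proof. by move=> /ltr_add_invr[n]; rewrite add0r; exists n. Qed.

Lemma invS_le1 (R : realType) n : invS R n <= 1.
Proof. by rewrite invf_le1 ?ler1n ?ltr0n. Qed.

Section local_lipschitz.
Context (R : realType) (X : normedModType R) (C : set X).
Local Notation v := (@set_val X C).
Implicit Types (x y u w : C) (t : R).

Lemma nbhs_set_typeP (x : C) (A : set C) : nbhs x A <->
  exists2 e : R, 0 < e & forall y : C, `|v y - v x| < e -> A y.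
Proof.
split=> [|[e e0 eA]].
  rewrite nbhsE => -[_ [[U Uo <-] Ux] UA].
  have /nbhs_ballP[e /= e0 eU] := open_nbhs_nbhs (conj Uo Ux).
  by exists e => // y yx; apply/UA/eU; rewrite -ball_normE/= distrC.
have vball : nbhs x (v @^-1` ball (v x) e).
  exact: (@initial_continuous C X v x _ (nbhsx_ballx (v x) e e0)).
apply: filterS vball => y; rewrite /= -ball_normE/= distrC; exact: eA.
Qed.

(** The upper limit is an infimum over right neighbourhoods of [0], so the radii below [r] already
    bound it. *)
Lemma lip_at_le (f : C -> C) (x : C) (r a : R) : 0 < r ->
  (forall y, `|v y - v x| < r -> `|v (f y) - v (f x)| <= a * `|v y - v x|) ->
  (lip_at f x <= a%:E)%E.
Proof.
move=> r0 fa; apply: (@le_trans _ _ (ereal_sup [set ereal_sup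
  [set (lip_quotient f y x)%:E | y in [set y : C | ball (v x) t (v y) /\ y <> x]]
    | t in [set t | t < r]])).
  apply: ereal_inf_lbound; exists [set t | t < r] => //.
  exact: nbhs_right_lt.
apply: ge_ereal_sup => _ [t /= tr <-]; apply: ge_ereal_sup => _ [y [yx nyx] <-].
rewrite lee_fin ler_pdivrMr.
  by apply: fa; rewrite -ball_normE/= distrC in yx; exact: lt_trans tr.
by rewrite normr_gt0 subr_eq0; apply/eqP => /val_inj.
Qed.

(** One index serves as both radius and gap to 1, so countably many sets capture all such points. *)
Lemma lip_at_lt1 (f : C -> C) (x : C) : (lip_at f x < 1%:E)%E ->
  exists k : nat, forall y, `|v y - v x| < invS R k ->
    `|v (f y) - v (f x)| <= (1 - invS R k) * `|v y - v x|.
Proof.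
move=> /ereal_inf_lt[_ [V V0 <-]] V1.
have [a a1 Va] : exists2 a : R, a < 1 & (ereal_sup
    [set ereal_sup [set (lip_quotient f y x)%:E |
      y in [set y : C | ball (v x) r (v y) /\ y <> x]] | r in V] <= a%:E)%E.
  move: V1; set B := ereal_sup _; case: B => [b b1|| _].
  - by exists b; rewrite -?lte_fin.
  - by rewrite ltNge leey.
  - by exists 0; rewrite ?leNye.
have /nbhs_ballP[e /= e0 eV] := V0.
have [|k] := @invS_lt R (Num.min (e / 2) (1 - a)).
  by rewrite lt_min divr_gt0// subr_gt0.
rewrite lt_min => /andP[ke ka].
exists k => y yx; have [->|/eqP nyx] := eqVneq y x.
  by rewrite !subrr !normr0 mulr0.
have yx0 : 0 < `|v y - v x|.
  by rewrite normr_gt0 subr_eq0; apply/eqP => /val_inj.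
rewrite -ler_pdivrMr//; apply: (@le_trans _ _ a); last by lra.
rewrite -lee_fin; apply: le_trans Va.
apply: (@le_trans _ _ (ereal_sup [set (lip_quotient f y x)%:E |
      y in [set y : C | ball (v x) (e / 2) (v y) /\ y <> x]])).
  apply: ereal_sup_ubound; exists y => //; split=> //.
  by rewrite -ball_normE/= distrC; exact: lt_trans ke.
apply: ereal_sup_ubound; exists (e / 2) => //; apply: eV; last by rewrite divr_gt0.
by rewrite -ball_normE/= sub0r normrN gtr0_norm ?divr_gt0//; lra.
Qed.

Lemma residual_lip_one_set (f : C -> C) (D : set X) :
  nonexpansive f -> dense D ->
  (forall (d : X) (k : nat), D d -> (relball d (invS R k) : set C) !=set0 ->
    ~ lip_le_on f (relball d (invS R k)) (1 - invS R k)) ->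
  residual (lip_one_set f).
Proof.
move=> /nonexpansiveP fne Ddense fD.
pose F (k : nat) := [set x : C | forall y, `|v y - v x| < invS R k ->
    `|v (f y) - v (f x)| <= (1 - invS R k) * `|v y - v x|].
have inv0 := invS_gt0 R.
exists F; split; last first.
  apply/seteqP; split=> x.
    (* Non-expansiveness gives [lip_at f x <= 1], so a value other than 1 is below 1. *)
    move=> /= /eqP; rewrite /lip_one_set/= => x1.
    have [k Fk] : exists k : nat, F k x; last by exists k.
    apply: lip_at_lt1; rewrite lt_neqAle x1 (@lip_at_le f x 1 1)// => y _.
    by rewrite mul1r.
  move=> [k _ Fk] /= x1; have := lip_at_le (inv0 k) Fk.
  by rewrite x1 lee_fin; have := inv0 k; lra.
move=> k; apply/seteqP; split=> // x /nbhs_set_typeP[rho rho0 rhoF] /=.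
(* A ball of radius [invS R K] about a point of [D] near [x] then stays within [rho] of [x] and has
   diameter below [invS R k]. *)
have [|K] := @invS_lt R (Num.min (rho / 2) (invS R k / 2)).
  by rewrite lt_min !divr_gt0//.
rewrite lt_min => /andP[Krho Kk].
have [d [xd Dd]] : ball (v x) (invS R K) `&` D !=set0.
  by apply: Ddense; [exists (v x); exact: ballxx|exact: ball_open].
rewrite -ball_normE/= in xd.
apply: (fD d K Dd); first by exists x.
move=> y z; rewrite /relball/= => yd zd.
apply/ler_addgt0Pr => e e0.
have yF : closure (F k) y.
  apply: rhoF; have := ler_distD d (v y) (v x).
  by rewrite (distrC d); lra.
(* Replacing [y] by [y'] in [F k] costs at most [2 * eta <= e]; the second bound keeps [z] within
   [invS R k] of [y']. *)
pose eta := Num.min (e / 2) (invS R k - 2 * invS R K).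
have eta0 : 0 < eta by rewrite lt_min divr_gt0//=; lra.
have [y' [Fy' y'y]] : F k `&` [set y' | `|v y' - v y| < eta] !=set0.
  by apply: yF; apply/nbhs_set_typeP; exists eta.
move: y'y; rewrite /= lt_min => /andP[y'e y'k].
have yz := ler_distD d (v y) (v z); rewrite (distrC d) in yz.
have zy' : `|v z - v y'| <= `|v y - v z| + `|v y' - v y|.
  by rewrite (distrC (v y) (v z)) (distrC (v y') (v y)) ler_distD.
have := Fy' z; rewrite /= => /(_ _)Fz.
have {}Fz := Fz (ltac:(lra)).
have := fne y' y; have := ler_distD (v (f y')) (v (f y)) (v (f z)).
rewrite (distrC (v (f y)) (v (f y'))) (distrC (v (f y')) (v (f z))).
have k1 : 0 <= 1 - invS R k :> R by rewrite subr_ge0 invS_le1.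
have : (1 - invS R k) * `|v z - v y'| <=
    (1 - invS R k) * (`|v y - v z| + `|v y' - v y|) by rewrite ler_wpM2l.
have : (1 - invS R k) * (`|v y - v z| + `|v y' - v y|) <=
    (1 - invS R K) * `|v y - v z| + `|v y' - v y|.
  rewrite mulrDr lerD//.
    by rewrite ler_wpM2r//; have := inv0 k; lra.
  by rewrite ler_piMl//; have := inv0 k; lra.
lra.
Qed.

End local_lipschitz.

(** * Union over countably many balls and constants *)

Theorem theorem2p2 (R : realType) (X : completeNormedModType R) (C : set X)
    (Xsep : separable X)
    (Cbounded : bounded_set C) (Cclosed : closed C)
    (Cconvex : @convex_set R X C)
    (Cnontriv : exists x y : X, [/\ C x, C y & x <> y]) :
  exists N : set (nonexpansive_map Cbounded),
    sigma_porous N /\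
    forall f : nonexpansive_map Cbounded, ~ N f -> residual (lip_one_set f).
Proof.
have [D [/pcard_surjP[d dD] Ddense]] := Xsep.
(* Indices coding no pair fall back to [(0, 0)] and only repeat a member of the family. *)
pose ij n : nat * nat := odflt (0%N, 0%N) (unpickle n).
pose A n := @contraction_on R X C Cbounded (d (ij n).1) (invS R (ij n).2)
  (1 - (invS R (ij n).2)).
exists (\bigcup_n A n); split.
  exists A; split=> // n; apply: porous_contraction_on => //.
  by rewrite ltrBlDr ltrDl invS_gt0.
move=> f fA; apply: (residual_lip_one_set (set_valP f) Ddense).
move=> p k /dD[i _ <-] Uk fk; apply: fA.
by exists (pickle (i, k)) => //; rewrite /A /ij pickleK.
Qed.
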